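(* For every real $\alpha$ with $|\alpha|\le 1$, $$\int_0^1\frac{(\arctan(\alpha x))^2}{x}\,dx=\frac12\sum_{n=1}^\infty(-1)^{n-1}\frac{h_n}{n^2}\,\alpha^{2n}.$$ In particular, for $\alpha=1$, $$\sum_{n=1}^\infty(-1)^{n-1}\frac{h_n}{n^2}=\pi G-\frac74\zeta(3).$$
   Context: For $n\ge 1$, $h_n=\sum_{k=1}^n\frac{1}{2k-1}=1+\frac13+\cdots+\frac1{2n-1}$. $G=\sum_{n=0}^\infty\frac{(-1)^n}{(2n+1)^2}$ is Catalan's constant and $\zeta(3)=\sum_{n=1}^\infty\frac1{n^3}$. *)

(* Defs.v *)
From Stdlib Require Export Reals.
From Coquelicot Require Export Coquelicot.
Open Scope R_scope.

(* The sum over 1 <= k <= n, which is empty (hence 0) for n = 0. *)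
Definition h (n : nat) : R := sum_n_m (fun k : nat => 1 / (2 * INR k - 1)) 1 n.

Definition Catalan : R := Series (fun n : nat => (-1) ^ n / (2 * INR n + 1) ^ 2).

(* Coquelicot series start at index 0: the term of index n >= 1 is read off
   at [S k], here and wherever a sum over n >= 1 is written. *)
Definition zeta3 : R := Series (fun k : nat => 1 / INR (S k) ^ 3).

(* Main.v *)
(* The Cauchy product of the series of atan t and 1 / (1 + t^2) has coefficients
   (-1)^k h_(k+1), and twice its primitive is (atan t)^2.
   With explicit remainders, each integration (a comparison of derivatives) divides
   the error by a factor of order n, and after dividing by x and integrating over
   [0, 1] the error is at most 1 / (2 (n + 2)), uniformly for |alpha| <= 1, including
   the endpoints.

   For the value at alpha = 1, the substitution x = tan (u / 2) turns the integral
   into one fourth of the integral of u^2 / sin u over [0, pi / 2]. Since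
   2 (sin u + sin 3u + ... + sin (2N-1)u) = (1 - cos 2Nu) / sin u, it is the limit of
   the sums of the integrals of 2 u^2 sin (2k+1)u, by the Riemann-Lebesgue argument;
   these are elementary and produce Catalan's constant and the sum of 1/(2k+1)^3. *)

Require Import Defs.
From Stdlib Require Import Reals Lra Lia.
From Coquelicot Require Import Coquelicot.
Open Scope R_scope.

(** * Increments compared through derivatives *)

(* The bound is required on the closed interval, where [df] and [dg] need not be
   derivatives, because the point given by [MVT_gen] may be an endpoint. *)
Lemma Rabs_increment_le_open (f g df dg : R -> R) (a b : R) :
  a <= b ->
  (forall x, a <= x <= b -> continuous f x) ->
  (forall x, a <= x <= b -> continuous g x) ->
  (forall x, a < x < b -> is_derive f x (df x)) ->
  (forall x, a < x < b -> is_derive g x (dg x)) ->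
  (forall x, a <= x <= b -> Rabs (df x) <= dg x) ->
  Rabs (f b - f a) <= g b - g a.
Proof.
  intros Hab Cf Cg Df Dg Hle.
  (* The absolute value is split into the signs [s = 1] and [s = -1]. For each, the mean value
     theorem applies to [g - s * f], whose derivative is nonnegative by the bound. *)
  assert (Hs : forall s : R, Rabs s = 1 -> s * (f b - f a) <= g b - g a).
  { intros s Hs.
    destruct (MVT_gen (fun x => g x - s * f x) a b (fun x => dg x - s * df x))
      as [c [Hc Heq]].
    - rewrite Rmin_left, Rmax_right by exact Hab. intros x Hx.
      apply @is_derive_minus; [now apply Dg|].
      apply is_derive_scal. now apply Df.
    - rewrite Rmin_left, Rmax_right by exact Hab. intros x Hx.
      apply continuity_pt_filterlim.
      apply (continuous_minus g (fun x => s * f x)); [now apply Cg|].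
      apply (continuous_scal_r s f). now apply Cf.
    - rewrite Rmin_left, Rmax_right in Hc by exact Hab.
      assert (s * df c <= dg c).
      { apply Rle_trans with (2 := Hle c Hc).
        rewrite <- (Rmult_1_l (Rabs (df c))), <- Hs, <- Rabs_mult.
        apply Rle_abs. }
      nra. }
  apply Rabs_le.
  assert (H1 := Hs 1 Rabs_R1).
  assert (H2 := Hs (-1) ltac:(rewrite Rabs_left; lra)).
  lra.
Qed.

Lemma Rabs_increment_le (f g df dg : R -> R) (a b : R) :
  a <= b ->
  (forall x, a <= x <= b -> is_derive f x (df x)) ->
  (forall x, a <= x <= b -> is_derive g x (dg x)) ->
  (forall x, a <= x <= b -> Rabs (df x) <= dg x) ->
  Rabs (f b - f a) <= g b - g a.
Proof.
  intros Hab Df Dg Hle.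
  apply (Rabs_increment_le_open f g df dg); auto.
  - intros x Hx. apply @ex_derive_continuous. eexists; apply Df, Hx.
  - intros x Hx. apply @ex_derive_continuous. eexists; apply Dg, Hx.
  - intros x Hx. apply Df; lra.
  - intros x Hx. apply Dg; lra.
Qed.

(** * Finite sums of powers and their derivatives *)

Lemma is_derive_pow_id (n : nat) (x : R) :
  is_derive (fun y => y ^ S n) x (INR (S n) * x ^ n).
Proof.
  rewrite <- (Rmult_1_r (INR (S n))).
  apply (is_derive_pow (fun y => y) (S n) x 1), (is_derive_id (K := R_AbsRing) x).
Qed.

Lemma sum_Sn_R (a : nat -> R) (n : nat) : sum_n a (S n) = sum_n a n + a (S n) :> R.
Proof. exact (sum_Sn a n). Qed.

Lemma sum_n_Rmult_l (a : R) (u : nat -> R) (n : nat) :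
  sum_n (fun k => a * u k) n = a * sum_n u n :> R.
Proof. exact (sum_n_mult_l a u n). Qed.

Lemma sum_n_ext_R (a b : nat -> R) (n : nat) :
  (forall k, a k = b k) -> sum_n a n = sum_n b n :> R.
Proof. exact (sum_n_ext a b n). Qed.

(** Exponents have the form [S (d k)] so that every term vanishes at 0 and differentiation needs no
    predecessor. Each comparison of derivatives on an interval starting at 0 then has no
    contribution from its left end. *)
Lemma pow_sum_at_0 (c : nat -> R) (d : nat -> nat) (n : nat) :
  sum_n (fun k => c k * 0 ^ S (d k)) n = 0 :> R.
Proof.
  induction n as [|n IH].
  - rewrite sum_O. simpl. ring.
  - rewrite sum_Sn_R, IH. simpl. ring.
Qed.

Lemma is_derive_pow_sum (c : nat -> R) (d : nat -> nat) (n : nat) (x : R) :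
  is_derive (fun y => sum_n (fun k => c k * y ^ S (d k)) n) x
    (sum_n (fun k => c k * (INR (S (d k)) * x ^ d k)) n).
Proof.
  apply (is_derive_sum_n (fun k y => c k * y ^ S (d k))).
  intros k _. apply is_derive_scal, is_derive_pow_id.
Qed.

(** * The numbers [h n] and Taylor estimates for the arctangent and its square *)

Lemma h_1 : h 1 = 1.
Proof. unfold h. rewrite sum_n_n. simpl. field. Qed.

Lemma h_SS (n : nat) : h (S (S n)) = h (S n) + 1 / (2 * INR n + 3).
Proof.
  unfold h. rewrite sum_n_Sm by lia. rewrite !S_INR.
  replace (2 * INR n + 3) with (2 * (INR n + 1 + 1) - 1) by ring. reflexivity.
Qed.

(** Linear growth is far from sharp but enough: the next integration divides by a factor of the same
    order. *)
Lemma h_S_bounds (n : nat) : 0 <= h (S n) <= INR n + 1.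
Proof.
  induction n as [|n IH].
  - rewrite h_1. simpl. lra.
  - rewrite h_SS, S_INR. assert (Hn := pos_INR n).
    assert (0 < 1 / (2 * INR n + 3) <= 1).
    { split; [apply Rdiv_lt_0_compat; lra|].
      apply (Rdiv_le_1 1); lra. }
    lra.
Qed.

(** The differentiated sum is geometric with ratio [- x ^ 2], so it differs from [/ (1 + x²)] by
    [x ^ (2 * n + 2) / (1 + x²)] in absolute value, which is at most [x ^ (2 * n + 2)]. *)
Lemma atan_taylor_le (n : nat) (t : R) : 0 <= t ->
  Rabs (atan t
        - sum_n (fun k => (-1) ^ k / (2 * INR k + 1) * t ^ S (2 * k)) n)
  <= t ^ S (2 * n + 2) / INR (S (2 * n + 2)).
Proof.
  intros Ht.
  set (c := fun k : nat => (-1) ^ k / (2 * INR k + 1)).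
  assert (H := Rabs_increment_le
    (fun x => atan x - sum_n (fun k => c k * x ^ S (2 * k)) n)
    (fun x => / INR (S (2 * n + 2)) * x ^ S (2 * n + 2))
    (fun x => / (1 + x²)
       - sum_n (fun k => c k * (INR (S (2 * k)) * x ^ (2 * k))) n)
    (fun x => / INR (S (2 * n + 2))
       * (INR (S (2 * n + 2)) * x ^ (2 * n + 2))) 0 t Ht).
  cbv beta in H. rewrite pow_sum_at_0, atan_0 in H.
  rewrite (pow_i (S (2 * n + 2))) in H by lia.
  replace (atan t - _ - (0 - 0))
    with (atan t - sum_n (fun k => c k * t ^ S (2 * k)) n) in H by ring.
  unfold Rdiv. rewrite Rmult_comm.
  replace (_ * t ^ _) with
    (/ INR (S (2 * n + 2)) * t ^ S (2 * n + 2) - / INR (S (2 * n + 2)) * 0)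
    by ring.
  apply H; clear H.
  - intros x _. apply @is_derive_minus; [apply is_derive_atan|].
    apply is_derive_pow_sum.
  - intros x _. apply is_derive_scal, is_derive_pow_id.
  - intros x _.
    assert (Hx : 0 < 1 + x²) by (unfold Rsqr; nra).
    assert (Hg : sum_n (fun k => c k * (INR (S (2 * k)) * x ^ (2 * k))) n
                 = (1 + (-1) ^ n * x ^ (2 * n + 2)) / (1 + x²) :> R).
    { unfold Rsqr in *. induction n as [|n IH].
      - rewrite sum_O. unfold c. simpl. field. lra.
      - rewrite sum_Sn_R, IH. unfold c.
        assert (Hn := pos_INR n).
        replace (INR (S (2 * S n))) with (2 * INR (S n) + 1)
          by (rewrite (S_INR (2 * S n)), mult_INR; simpl (INR 2); ring).
        replace (2 * S n + 2)%nat with (S (S (2 * n + 2))) by lia.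
        replace (2 * S n)%nat with (2 * n + 2)%nat by lia.
        rewrite <- !tech_pow_Rmult, S_INR. field. split; lra. }
    rewrite Hg, <- Rmult_assoc, Rinv_l, Rmult_1_l
      by (apply not_0_INR; lia).
    replace (/ (1 + x²) - _)
      with ((-1) ^ S n * (x ^ (2 * n + 2) * / (1 + x²)))
      by (simpl; field; lra).
    assert (Hp : 0 <= x ^ (2 * n + 2)).
    { replace (2 * n + 2)%nat with (2 * S n)%nat by lia.
      rewrite pow_mult. apply pow_le, pow2_ge_0. }
    rewrite Rabs_mult, pow_1_abs, Rmult_1_l, Rabs_pos_eq.
    + rewrite <- (Rmult_1_r (x ^ _)) at 2.
      apply Rmult_le_compat_l; [exact Hp|].
      rewrite <- Rinv_1. apply Rinv_le_contravar; unfold Rsqr; nra.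
    + apply Rmult_le_pos; [exact Hp|]. apply Rlt_le, Rinv_0_lt_compat, Hx.
Qed.

(** Multiplication by [1 + t²] turns the sum into the Taylor sum of [atan t] plus one boundary term.
    The Taylor error is at most [t ^ S (2 * n + 2)] and the boundary term at most [INR n + 1] times
    that power; dividing back by [1 + t² >= 1] only helps. *)
Lemma atan_div_taylor_le (n : nat) (t : R) : 0 <= t ->
  Rabs (atan t / (1 + t²) - sum_n (fun k => (-1) ^ k * h (S k) * t ^ S (2 * k)) n)
  <= (INR n + 2) * t ^ S (2 * n + 2).
Proof.
  intros Ht.
  assert (Hx : 1 <= 1 + t²) by (unfold Rsqr; nra).
  (* Summation by parts: [h] has increments [1 / (2 k + 1)]. *)
  assert (Heq : (1 + t²) * sum_n (fun k => (-1) ^ k * h (S k) * t ^ S (2 * k)) n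
    = sum_n (fun k => (-1) ^ k / (2 * INR k + 1) * t ^ S (2 * k)) n
      + (-1) ^ n * (h (S n) * t ^ S (2 * n + 2)) :> R).
  { unfold Rsqr in *. induction n as [|n IH].
    - rewrite !sum_O, h_1. simpl. field.
    - rewrite !sum_Sn_R.
      rewrite Rmult_plus_distr_l, IH, h_SS.
      assert (Hn := pos_INR n).
      replace (2 * S n + 2)%nat with (S (S (2 * n + 2))) by lia.
      replace (2 * S n)%nat with (2 * n + 2)%nat by lia.
      rewrite <- !tech_pow_Rmult, S_INR. field. lra. }
  apply Rmult_le_reg_l with (1 + t²); [lra|].
  rewrite <- (Rabs_pos_eq (1 + t²)) at 1 by lra.
  rewrite <- Rabs_mult.
  replace ((1 + t²) * _) with
    ((atan t - sum_n (fun k => (-1) ^ k / (2 * INR k + 1) * t ^ S (2 * k)) n)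
     - (-1) ^ n * (h (S n) * t ^ S (2 * n + 2)))
    by (rewrite Rmult_minus_distr_l, Heq; field; lra).
  assert (Hp : 0 <= t ^ S (2 * n + 2)) by now apply pow_le.
  assert (Hh := h_S_bounds n).
  assert (Ha := atan_taylor_le n t Ht).
  apply Rle_trans with (1 * ((INR n + 2) * t ^ S (2 * n + 2))).
  2: { apply Rmult_le_compat_r; [nra|exact Hx]. }
  eapply Rle_trans; [apply Rabs_triang|].
  rewrite Rabs_Ropp, Rabs_mult, pow_1_abs, Rmult_1_l.
  rewrite (Rabs_pos_eq (h _ * _)) by nra.
  assert (t ^ S (2 * n + 2) / INR (S (2 * n + 2)) <= t ^ S (2 * n + 2)).
  { rewrite <- (Rmult_1_r (t ^ _)) at 2. apply Rmult_le_compat_l; [exact Hp|].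
    rewrite <- Rinv_1. apply Rinv_le_contravar; [lra|].
    rewrite S_INR. assert (Hi := pos_INR (2 * n + 2)). lra. }
  nra.
Qed.

(** The derivative of [atan x ^ 2] is twice the function estimated in [atan_div_taylor_le]. The
    growing factor [INR n + 2] disappears because its double is the exponent that differentiating
    [x ^ (2 * n + 4)] brings down. *)
Lemma atan_sqr_taylor_le (n : nat) (t : R) :
  Rabs (atan t ^ 2
        - sum_n (fun k => (-1) ^ k * h (S k) / INR (S k) * t ^ (2 * S k)) n)
  <= t ^ (2 * S (S n)).
Proof.
  assert (Hpos : forall t, 0 <= t ->
  Rabs (atan t ^ 2
        - sum_n (fun k => (-1) ^ k * h (S k) / INR (S k) * t ^ (2 * S k)) n)
  <= t ^ (2 * S (S n))).
  { clear t. intros t Ht.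
    set (c := fun k : nat => (-1) ^ k * h (S k) / INR (S k)).
    assert (H := Rabs_increment_le
      (fun x => atan x ^ 2 - sum_n (fun k => c k * x ^ S (2 * k + 1)) n)
      (fun x => x ^ S (2 * n + 3))
      (fun x => 2 * (atan x / (1 + x²))
         - sum_n (fun k => c k * (INR (S (2 * k + 1)) * x ^ (2 * k + 1))) n)
      (fun x => INR (S (2 * n + 3)) * x ^ (2 * n + 3)) 0 t Ht).
    cbv beta in H. rewrite pow_sum_at_0, atan_0 in H.
    rewrite (pow_i (S (2 * n + 3))) in H by lia.
    replace (_ - (0 ^ 2 - 0))
      with (atan t ^ 2 - sum_n (fun k => c k * t ^ (2 * S k)) n) in H.
    2: { rewrite (sum_n_ext_R (fun k => c k * t ^ S (2 * k + 1))
                            (fun k => c k * t ^ (2 * S k))).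
         - ring.
         - intros k. do 2 f_equal. lia. }
    replace (2 * S (S n))%nat with (S (2 * n + 3)) by lia.
    rewrite <- (Rminus_0_r (t ^ S _)).
    apply H; clear H.
    - intros x _. apply @is_derive_minus; [|apply is_derive_pow_sum].
      auto_derive; [trivial|]. unfold Rsqr. field. nra.
    - intros x _. apply is_derive_pow_id.
    - intros x [Hx _].
      rewrite (sum_n_ext_R _ (fun k => 2 * ((-1) ^ k * h (S k) * x ^ S (2 * k)))).
      2: { intros k. unfold c.
           replace (2 * k + 1)%nat with (S (2 * k)) by lia.
           replace (INR (S (S (2 * k)))) with (2 * INR (S k))
             by (rewrite !S_INR, mult_INR; simpl (INR 2); ring).
           field. apply not_0_INR. lia. }
      rewrite sum_n_Rmult_l.
      rewrite <- Rmult_minus_distr_l, Rabs_mult, (Rabs_pos_eq 2) by lra.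
      replace (INR (S (2 * n + 3))) with (2 * (INR n + 2))
        by (rewrite S_INR, plus_INR, mult_INR; simpl; ring).
      rewrite Rmult_assoc. apply Rmult_le_compat_l; [lra|].
      replace (2 * n + 3)%nat with (S (2 * n + 2)) by lia.
      now apply atan_div_taylor_le. }
  (* Both sides are even in [t], so negative arguments reduce to positive ones. *)
  destruct (Rle_or_lt 0 t) as [Ht|Ht]; [now apply Hpos|].
  assert (H := Hpos (- t) ltac:(lra)).
  rewrite atan_opp in H.
  assert (He : forall k, (- t) ^ (2 * k) = t ^ (2 * k))
    by (intros k; rewrite !pow_mult; f_equal; ring).
  rewrite He in H.
  rewrite (sum_n_ext_R _ (fun k => (-1) ^ k * h (S k) / INR (S k) * t ^ (2 * S k)))
    in H by (intros k; now rewrite He).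
  replace ((- atan t) ^ 2) with (atan t ^ 2) in H by ring.
  exact H.
Qed.

(** * Convergence criteria for series *)

Lemma is_series_of_error_le (a : nat -> R) (l C : R) :
  (forall n, Rabs (sum_n a n - l) <= C / INR (S n)) -> is_series a l.
Proof.
  intros H.
  assert (Hz : is_lim_seq (fun n => C / INR (S n)) 0).
  { replace (Finite 0) with (Rbar_mult C (Rbar_inv p_infty))
      by (simpl; now rewrite Rmult_0_r).
    apply is_lim_seq_scal_l.
    apply (is_lim_seq_incr_1 (fun n => / INR n)).
    apply is_lim_seq_inv; [apply is_lim_seq_INR|discriminate]. }
  change (is_lim_seq (sum_n a) l).
  apply is_lim_seq_ext with (fun n => (sum_n a n - l) + l).
  { intros n. ring. }
  replace (Finite l) with (Finite (0 + l)) by (f_equal; ring).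
  apply is_lim_seq_plus'; [|apply is_lim_seq_const].
  apply is_lim_seq_abs_0.
  apply (is_lim_seq_le_le (fun _ => 0) _ (fun n => C / INR (S n)));
    [|apply is_lim_seq_const|exact Hz].
  intros n. split; [apply Rabs_pos|apply H].
Qed.

(** The majorant is [2 / ((n + 1) * (n + 2))], with partial sums [2 - 2 / (n + 2)]. The factor 2
    makes its first term 1, as needed for the series of [Catalan] and [zeta3], which both start with
    1. *)
Lemma ex_series_of_telescope (a : nat -> R) :
  (forall n, Rabs (a n) <= 2 * (1 / (INR n + 1) - 1 / (INR n + 2))) ->
  ex_series a.
Proof.
  intros H. apply (ex_series_le a (fun n => 2 * (1 / (INR n + 1) - 1 / (INR n + 2)))).
  { exact H. }
  exists 2. apply (is_series_of_error_le _ 2 2). intros n.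
  assert (Hs : sum_n (fun n => 2 * (1 / (INR n + 1) - 1 / (INR n + 2))) n
               = 2 - 2 / (INR n + 2) :> R).
  { induction n as [|n IH].
    - rewrite sum_O. simpl. field.
    - rewrite sum_Sn_R, IH, S_INR. assert (Hn := pos_INR n). field. lra. }
  rewrite Hs, S_INR. assert (Hn := pos_INR n).
  replace (2 - _ - 2) with (- (2 / (INR n + 2))) by ring.
  rewrite Rabs_Ropp, Rabs_pos_eq.
  - apply Rmult_le_compat_l; [lra|]. apply Rinv_le_contravar; lra.
  - apply Rlt_le, Rdiv_lt_0_compat; lra.
Qed.

(** * The integral of the squared arctangent over x, and its series *)

(** Meant for quotients such as [atan (alpha * x) ^ 2 / x] and [u ^ 2 / sin u], whose default value
    0 at the singular point is also their limit there. *)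
Lemma continuous_0_of_Rabs_le (f : R -> R) (C d : R) :
  0 < d -> f 0 = 0 -> (forall x, Rabs x < d -> Rabs (f x) <= C * Rabs x) ->
  continuous f 0.
Proof.
  intros Hd H0 H. apply continuity_pt_filterlim.
  (* [Rabs C + 1] is a positive denominator whatever the sign of [C]. *)
  intros e He. exists (Rmin d (e / (Rabs C + 1))).
  assert (HC := Rabs_pos C).
  assert (Hq : 0 < e / (Rabs C + 1)) by (apply Rdiv_lt_0_compat; lra).
  split; [now apply Rmin_pos|].
  intros x [_ Hx]. simpl in *. unfold R_dist in *.
  rewrite Rminus_0_r in Hx. rewrite H0, Rminus_0_r.
  assert (Hx1 : Rabs x < d) by (eapply Rlt_le_trans; [exact Hx|apply Rmin_l]).
  assert (Hx2 : Rabs x < e / (Rabs C + 1))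
    by (eapply Rlt_le_trans; [exact Hx|apply Rmin_r]).
  apply Rle_lt_trans with (1 := H x Hx1).
  assert (Hx3 : Rabs x * (Rabs C + 1) < e).
  { apply Rmult_lt_reg_r with (/ (Rabs C + 1)); [apply Rinv_0_lt_compat; lra|].
    rewrite Rmult_assoc, Rinv_r, Rmult_1_r by lra. exact Hx2. }
  assert (HCC := Rle_abs C). assert (Hxx := Rabs_pos x). nra.
Qed.

Lemma atan_le (t : R) : Rabs (atan t) <= Rabs t.
Proof.
  assert (Hpos : forall t, 0 <= t -> Rabs (atan t) <= t).
  { clear t. intros t Ht.
    assert (H := Rabs_increment_le atan (fun x => x) (fun x => / (1 + x²))
      (fun _ => 1) 0 t Ht).
    rewrite atan_0, !Rminus_0_r in H. apply H.
    - intros x _. apply is_derive_atan.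
    - intros x _. apply (is_derive_id (K := R_AbsRing)).
    - intros x _. assert (0 <= x²) by apply Rle_0_sqr.
      rewrite Rabs_pos_eq by (apply Rlt_le, Rinv_0_lt_compat; lra).
      rewrite <- Rinv_1. apply Rinv_le_contravar; lra. }
  destruct (Rle_or_lt 0 t) as [Ht|Ht].
  - rewrite (Rabs_pos_eq t Ht). now apply Hpos.
  - rewrite (Rabs_left t Ht), <- (Ropp_involutive t) at 1.
    rewrite atan_opp, Rabs_Ropp. apply Hpos. lra.
Qed.

Lemma atan_sqr_div_continuous (alpha x : R) :
  continuous (fun x => atan (alpha * x) ^ 2 / x) x.
Proof.
  destruct (Req_dec x 0) as [->|Hx].
  - apply (continuous_0_of_Rabs_le _ (alpha ^ 2) 1); [lra| |].
    + rewrite Rmult_0_r, atan_0. unfold Rdiv. ring.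
    + intros x _. destruct (Req_dec x 0) as [->|Hx].
      { rewrite Rmult_0_r, atan_0. unfold Rdiv.
        replace (0 ^ 2 * / 0) with 0 by ring. rewrite Rabs_R0. lra. }
      unfold Rdiv. rewrite Rabs_mult, Rabs_inv, <- RPow_abs.
      assert (Ha : Rabs x > 0) by now apply Rabs_pos_lt.
      apply Rmult_le_reg_r with (Rabs x); [exact Ha|].
      rewrite Rmult_assoc, Rinv_l, Rmult_1_r by lra.
      replace (alpha ^ 2 * Rabs x * Rabs x) with (Rabs (alpha * x) ^ 2)
        by (rewrite Rabs_mult, Rpow_mult_distr, <- (pow2_abs alpha); ring).
      apply pow_incr. split; [apply Rabs_pos|apply atan_le].
  - apply @ex_derive_continuous. auto_derive. exact Hx.
Qed.

Lemma atan_sqr_div_ex_RInt (alpha a b : R) :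
  ex_RInt (fun x => atan (alpha * x) ^ 2 / x) a b.
Proof.
  apply (ex_RInt_continuous (V := R_CompleteNormedModule)).
  intros x _. apply atan_sqr_div_continuous.
Qed.

Lemma atan_sqr_div_is_derive (alpha b : R) :
  is_derive (fun b => RInt (fun x => atan (alpha * x) ^ 2 / x) 0 b) b
    (atan (alpha * b) ^ 2 / b).
Proof.
  apply (is_derive_RInt (fun x => atan (alpha * x) ^ 2 / x) _ 0 b).
  - apply filter_forall. intros y.
    apply (RInt_correct (V := R_CompleteNormedModule)), atan_sqr_div_ex_RInt.
  - apply atan_sqr_div_continuous.
Qed.

(** The estimate of [atan_sqr_taylor_le] at [alpha * x], divided by [x], bounds the difference of
    the integrands by [x ^ (2 * n + 3)], since [Rabs alpha <= 1]. Comparing derivatives in the upper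
    limit [b] integrates this over [0, 1]. *)
Lemma RInt_atan_sqr_div_taylor_le (alpha : R) (n : nat) : Rabs alpha <= 1 ->
  Rabs (RInt (fun x => atan (alpha * x) ^ 2 / x) 0 1
        - sum_n (fun k => (-1) ^ k * h (S k) / INR (S k) ^ 2 / 2 * alpha ^ (2 * S k)) n)
  <= / (2 * (INR n + 2)).
Proof.
  intros Ha.
  set (c := fun k : nat => (-1) ^ k * h (S k) / INR (S k) ^ 2 / 2 * alpha ^ (2 * S k)).
  assert (H := Rabs_increment_le
    (fun b => RInt (fun x => atan (alpha * x) ^ 2 / x) 0 b
              - sum_n (fun k => c k * b ^ S (2 * k + 1)) n)
    (fun b => / INR (S (2 * n + 3)) * b ^ S (2 * n + 3))
    (fun b => atan (alpha * b) ^ 2 / b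
       - sum_n (fun k => c k * (INR (S (2 * k + 1)) * b ^ (2 * k + 1))) n)
    (fun b => / INR (S (2 * n + 3)) * (INR (S (2 * n + 3)) * b ^ (2 * n + 3))) 0 1).
  cbv beta in H. rewrite pow_sum_at_0, RInt_point in H.
  rewrite pow1, (pow_i (S (2 * n + 3))) in H by lia.
  replace (INR (S (2 * n + 3))) with (2 * (INR n + 2)) in H
    by (rewrite S_INR, plus_INR, mult_INR; simpl; ring).
  rewrite (sum_n_ext_R _ c) in H by (intros k; rewrite pow1; ring).
  replace (/ (2 * (INR n + 2))) with
    (/ (2 * (INR n + 2)) * 1 - / (2 * (INR n + 2)) * 0) by ring.
  rewrite <- (Rminus_0_r (_ - _)).
  change (@zero _) with 0 in H. rewrite (Rminus_0_r 0) in H.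
  assert (Hn := pos_INR n).
  apply H; clear H; [lra| | |].
  - intros x _. apply @is_derive_minus; [apply atan_sqr_div_is_derive|].
    apply is_derive_pow_sum.
  - intros x _. apply is_derive_scal.
    replace (2 * (INR n + 2)) with (INR (S (2 * n + 3)))
      by (rewrite S_INR, plus_INR, mult_INR; simpl; ring).
    apply is_derive_pow_id.
  - intros x [Hx _].
    rewrite <- Rmult_assoc, Rinv_l, Rmult_1_l by lra.
    rewrite (sum_n_ext_R _ (fun k =>
      / x * ((-1) ^ k * h (S k) / INR (S k) * (alpha * x) ^ (2 * S k)))).
    2: { intros k. unfold c.
         rewrite Rpow_mult_distr.
         replace (2 * S k)%nat with (S (2 * k + 1)) by lia.
         rewrite <- (tech_pow_Rmult x).
         replace (INR (S (2 * k + 1))) with (2 * INR (S k))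
           by (rewrite !S_INR, plus_INR, mult_INR; simpl (INR 2); simpl (INR 1); ring).
         destruct (Req_dec x 0) as [->|Hx0].
         - replace (2 * k + 1)%nat with (S (2 * k)) by lia. simpl. ring.
         - field. split; [|assumption]. apply not_0_INR. lia. }
    rewrite sum_n_Rmult_l.
    unfold Rdiv at 1. rewrite (Rmult_comm _ (/ x)), <- Rmult_minus_distr_l, Rabs_mult.
    destruct (Req_dec x 0) as [->|Hx0].
    (* At [x = 0] the default [/ 0 = 0] makes the left side vanish. *)
    { rewrite Rinv_0, Rabs_R0, Rmult_0_l. apply pow_le. lra. }
    assert (Hi : 0 < / x) by (apply Rinv_0_lt_compat; lra).
    rewrite (Rabs_pos_eq (/ x)) by lra.
    replace (x ^ (2 * n + 3)) with (/ x * x ^ (2 * S (S n))).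
    2: { replace (2 * S (S n))%nat with (S (2 * n + 3)) by lia.
         rewrite <- tech_pow_Rmult. field. exact Hx0. }
    apply Rmult_le_compat_l; [lra|].
    eapply Rle_trans; [apply atan_sqr_taylor_le|].
    rewrite !pow_mult. apply pow_incr. split; [apply pow2_ge_0|].
    rewrite Rpow_mult_distr, <- (pow2_abs alpha).
    rewrite <- (Rmult_1_l (x ^ 2)) at 2.
    apply Rmult_le_compat_r; [apply pow2_ge_0|].
    assert (Hp := Rabs_pos alpha). nra.
Qed.

Lemma is_series_RInt_atan_sqr_div (alpha : R) : Rabs alpha <= 1 ->
  is_series (fun k => (-1) ^ k * (h (S k) / INR (S k) ^ 2) * alpha ^ (2 * S k))
    (2 * RInt (fun x => atan (alpha * x) ^ 2 / x) 0 1).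
Proof.
  intros Ha. apply (is_series_of_error_le _ _ 1). intros n.
  assert (H := RInt_atan_sqr_div_taylor_le alpha n Ha).
  rewrite (sum_n_ext_R _ (fun k =>
    2 * ((-1) ^ k * h (S k) / INR (S k) ^ 2 / 2 * alpha ^ (2 * S k))))
    by (intros k; field; apply not_0_INR; lia).
  rewrite sum_n_Rmult_l, <- Rmult_minus_distr_l, Rabs_mult, (Rabs_pos_eq 2), Rabs_minus_sym
    by lra.
  assert (Hn := pos_INR n).
  apply Rle_trans with (2 * / (2 * (INR n + 2))); [apply Rmult_le_compat_l; lra|].
  replace (2 * / (2 * (INR n + 2))) with (/ (INR n + 2)) by (field; lra).
  rewrite S_INR. unfold Rdiv. rewrite Rmult_1_l. apply Rinv_le_contravar; lra.
Qed.

(** * The substitution x = tan (u / 2) and sums of odd sines *)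

(** The change of variables in differentiated form: the chain rule contributes
    [(tan (u / 2) ^ 2 + 1) / 2], and the double angle formula for [sin u] absorbs the tangent. At
    [u = 0] both quotients take the default value 0. *)
Lemma RInt_tan_half_is_derive (u : R) : - PI < u < PI ->
  is_derive (fun u => 4 * RInt (fun x => atan (1 * x) ^ 2 / x) 0 (tan (u / 2))) u
    (u ^ 2 / sin u).
Proof.
  intros Hu.
  assert (Hc : 0 < cos (u / 2)) by (apply cos_gt_0; lra).
  replace (u ^ 2 / sin u) with (4 * (((tan (u / 2) ^ 2 + 1) * / 2)
    * (atan (1 * tan (u / 2)) ^ 2 / tan (u / 2)))).
  - apply is_derive_scal.
    apply (is_derive_comp (fun b => RInt (fun x => atan (1 * x) ^ 2 / x) 0 b)
             (fun u => tan (u / 2))).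
    + apply atan_sqr_div_is_derive.
    + rewrite Rmult_comm.
      apply (is_derive_comp tan (fun u => u / 2)).
      * apply is_derive_tan. lra.
      * auto_derive; [trivial|]. field.
  - rewrite Rmult_1_l, atan_tan by lra.
    destruct (Req_dec u 0) as [->|Hu0].
    + unfold Rdiv. ring.
    + assert (Hs : sin (u / 2) <> 0).
      { destruct (Rtotal_order u 0) as [Hlt|[Heq|Hgt]]; [|easy|].
        - assert (sin (u / 2) < 0) by (apply sin_lt_0_var; lra). lra.
        - assert (0 < sin (u / 2)) by (apply sin_gt_0; lra). lra. }
      replace (sin u) with (2 * sin (u / 2) * cos (u / 2))
        by (rewrite <- sin_2a; f_equal; field).
      assert (Hsc := sin2_cos2 (u / 2)). unfold Rsqr in Hsc.
      unfold tan.
      replace ((sin (u / 2) / cos (u / 2)) ^ 2 + 1)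
        with ((sin (u / 2) * sin (u / 2) + cos (u / 2) * cos (u / 2)) / cos (u / 2) ^ 2)
        by (field; lra).
      rewrite Hsc. field. lra.
Qed.

(** From [sin u >= u - u ^ 3 / 6] and [u <= 2], the latter because [PI <= 4]. *)
Lemma sin_ge_third (u : R) : 0 <= u <= PI / 2 -> u / 3 <= sin u.
Proof.
  intros Hu. assert (HPI := PI_4).
  destruct (pre_sin_bound u 0) as [H _]; [lra|lra|].
  unfold sin_approx, sin_term in H. simpl in H.
  assert (u * u <= 4) by nra. nra.
Qed.

Lemma sqr_div_sin_continuous (u : R) : 0 <= u <= PI / 2 ->
  continuous (fun u => u ^ 2 / sin u) u.
Proof.
  intros Hu. assert (HPI := PI_RGT_0).
  destruct (Req_dec u 0) as [->|Hu0].
  - apply (continuous_0_of_Rabs_le _ 3 (PI / 2)); [lra| |].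
    + unfold Rdiv. ring.
    + intros x Hx. destruct (Req_dec x 0) as [->|Hx0].
      { unfold Rdiv. replace (0 ^ 2 * / sin 0) with 0 by ring. rewrite Rabs_R0. lra. }
      assert (Ha : 0 < Rabs x) by now apply Rabs_pos_lt.
      assert (Hs : Rabs x / 3 <= Rabs (sin x)).
      { apply Rle_trans with (sin (Rabs x)); [apply sin_ge_third; lra|].
        unfold Rabs at 1. destruct (Rcase_abs x); [|apply Rle_abs].
        rewrite sin_neg, <- Rabs_Ropp. apply Rle_abs. }
      unfold Rdiv. rewrite Rabs_mult, Rabs_inv, <- RPow_abs.
      apply Rmult_le_reg_r with (Rabs (sin x)); [lra|].
      rewrite Rmult_assoc, Rinv_l by lra. nra.
  - assert (0 < sin u) by (apply sin_gt_0; lra).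
    apply @ex_derive_continuous. auto_derive. lra.
Qed.

Lemma odd_half_PI (k : nat) :
  sin ((2 * INR k + 1) * (PI / 2)) = (-1) ^ k /\ cos ((2 * INR k + 1) * (PI / 2)) = 0.
Proof.
  induction k as [|k [IHs IHc]].
  - simpl INR. rewrite Rmult_0_r, Rplus_0_l, Rmult_1_l, sin_PI2, cos_PI2. easy.
  - rewrite S_INR.
    replace ((2 * (INR k + 1) + 1) * (PI / 2)) with ((2 * INR k + 1) * (PI / 2) + PI)
      by field.
    rewrite neg_sin, neg_cos, IHs, IHc. simpl. split; ring.
Qed.

(** Telescoping: [2 * sin v * sin u = cos (v - u) - cos (v + u)], with [v] running over odd
    multiples of [u]. *)
Lemma sum_sin_odd (n : nat) (u : R) :
  sum_n (fun k => 2 * sin ((2 * INR k + 1) * u)) n * sin u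
  = 1 - cos (2 * INR (S n) * u).
Proof.
  induction n as [|n IH].
  - rewrite sum_O. simpl INR.
    replace ((2 * 0 + 1) * u) with u by ring.
    replace (2 * 1 * u) with (2 * u) by ring. rewrite cos_2a_sin. ring.
  - rewrite sum_Sn_R, Rmult_plus_distr_r, IH.
    rewrite (S_INR (S n)).
    set (v := (2 * INR (S n) + 1) * u).
    replace (2 * INR (S n) * u) with (v - u) by (unfold v; ring).
    replace (2 * (INR (S n) + 1) * u) with (v + u) by (unfold v; ring).
    rewrite cos_minus, cos_plus. ring.
Qed.

Lemma is_derive_sqr_sin_primitive (m u : R) : 0 < m ->
  is_derive (fun u => 2 * (- u ^ 2 * cos (m * u) / m + 2 * u * sin (m * u) / m ^ 2
                      + 2 * cos (m * u) / m ^ 3)) u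
    (u ^ 2 * (2 * sin (m * u))).
Proof. intros Hm. auto_derive; [trivial|]. field. lra. Qed.

(** The sum consists of the integrals of [u ^ 2 * (2 * sin (m k * u))] over [0, pi / 2]. By
    [sum_sin_odd], its difference from the integral of [u ^ 2 / sin u] is an oscillating integral of
    frequency [N = 2 * (n + 1)], which is of order [1 / N]. *)
Lemma RInt_atan_sqr_div_odd_sum_le (n : nat) :
  Rabs (4 * RInt (fun x => atan (1 * x) ^ 2 / x) 0 1
        - sum_n (fun k => 2 * (PI * ((-1) ^ k / (2 * INR k + 1) ^ 2)
                               - 2 / (2 * INR k + 1) ^ 3)) n)
  <= 15 / INR (S n).
Proof.
  assert (HPI := PI_RGT_0). assert (HPI4 := PI_4).
  set (N := 2 * INR (S n)).
  assert (HN : 0 < N) by (unfold N; rewrite S_INR; assert (Hn := pos_INR n); lra).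
  set (m := fun k : nat => 2 * INR k + 1).
  assert (Hm : forall k, 0 < m k) by (intros k; unfold m; assert (Hk := pos_INR k); lra).
  set (V := fun (k : nat) (u : R) =>
    2 * (- u ^ 2 * cos (m k * u) / m k + 2 * u * sin (m k * u) / m k ^ 2
         + 2 * cos (m k * u) / m k ^ 3)).
  set (E := fun u => 4 * RInt (fun x => atan (1 * x) ^ 2 / x) 0 (tan (u / 2))
                     - sum_n (fun k => V k u) n).
  assert (DE : forall u, - PI < u < PI ->
    is_derive E u (u ^ 2 / sin u - sum_n (fun k => u ^ 2 * (2 * sin (m k * u))) n)).
  { intros u Hu. apply @is_derive_minus; [now apply RInt_tan_half_is_derive|].
    apply (is_derive_sum_n V n u (fun k => u ^ 2 * (2 * sin (m k * u)))).
    intros k _. now apply is_derive_sqr_sin_primitive. }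
  (* [E' u = u ^ 2 / sin u * cos (N * u)]: one integration by parts, done by
     subtracting the boundary term, gains a factor [1 / N]. At [u = 0] the formula
     for the derivative has the junk value [0], which satisfies the bound. *)
  assert (H := Rabs_increment_le_open
    (fun u => E u - u ^ 2 / sin u * (sin (N * u) / N)) (fun u => 15 / N * u)
    (fun u => - ((2 * u * sin u - u ^ 2 * cos u) / sin u ^ 2 * (sin (N * u) / N)))
    (fun _ => 15 / N) 0 (PI / 2)).
  assert (HB : E (PI / 2) - PI ^ 2 / 4 * 0 - E 0
    = 4 * RInt (fun x => atan (1 * x) ^ 2 / x) 0 1
        - sum_n (fun k => 2 * (PI * ((-1) ^ k / (2 * INR k + 1) ^ 2)
                               - 2 / (2 * INR k + 1) ^ 3)) n).
  { unfold E.
    replace (PI / 2 / 2) with (PI / 4) by field.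
    rewrite tan_PI4. replace (0 / 2) with 0 by field. rewrite tan_0, RInt_point.
    change (@zero _) with 0.
    assert (HV : sum_n (fun k => 2 * (PI * ((-1) ^ k / (2 * INR k + 1) ^ 2)
                               - 2 / (2 * INR k + 1) ^ 3)) n
      = sum_n (fun k => V k (PI / 2)) n - sum_n (fun k => V k 0) n :> R).
    { rewrite (sum_n_ext_R _ (fun k => V k (PI / 2) - V k 0)).
      - clear. induction n as [|n IH].
        + now rewrite !sum_O.
        + rewrite !sum_Sn_R, IH. ring.
      - intros k. unfold V, m. destruct (odd_half_PI k) as [-> ->].
        rewrite !Rmult_0_r, sin_0, cos_0.
        assert (Hk := Hm k). unfold m in Hk. field. lra. }
    rewrite HV. ring. }
  (* [N * (PI / 2)] is a whole multiple of [PI] because [N] is even, so the boundary term vanishes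
     at [PI / 2] as well as at 0. *)
  assert (HsN : sin (N * (PI / 2)) = 0).
  { apply sin_eq_0_1. exists (Z.of_nat (S n)). rewrite <- INR_IZR_INZ.
    unfold N. field. }
  cbv beta in H. rewrite HsN, Rmult_0_r, sin_0 in H.
  replace (E (PI / 2) - _ - (E 0 - 0 ^ 2 / 0 * (0 / N)))
    with (E (PI / 2) - PI ^ 2 / 4 * 0 - E 0) in H
    by (unfold Rdiv; ring).
  rewrite HB in H.
  apply Rle_trans with (15 / N * (PI / 2) - 15 / N * 0).
  (* The bound is [15 * (PI / 4) / INR (S n)], and [PI <= 4]. *)
  2: { assert (Hn := pos_INR (S n)). unfold N.
       assert (0 < INR (S n)) by (apply lt_0_INR; lia).
       replace (15 / (2 * INR (S n)) * (PI / 2) - 15 / (2 * INR (S n)) * 0)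
         with (15 * (PI / 4) / INR (S n)) by (field; lra).
       apply Rmult_le_compat_r; [apply Rlt_le, Rinv_0_lt_compat; lra|lra]. }
  apply H; clear H HB; [lra| | | | |].
  - intros u Hu.
    apply (continuous_minus E (fun u => u ^ 2 / sin u * (sin (N * u) / N))).
    + apply @ex_derive_continuous. eexists. apply DE. lra.
    + apply (continuous_mult (fun u => u ^ 2 / sin u) (fun u => sin (N * u) / N)).
      * now apply sqr_div_sin_continuous.
      * apply @ex_derive_continuous. auto_derive. lra.
  - intros u _. apply @ex_derive_continuous. auto_derive. trivial.
  - intros u Hu.
    assert (Hs : 0 < sin u) by (apply sin_gt_0; lra).
    replace (- _) with
      ((u ^ 2 / sin u - sum_n (fun k => u ^ 2 * (2 * sin (m k * u))) n)
       - ((2 * u * sin u - u ^ 2 * cos u) / sin u ^ 2 * (sin (N * u) / N)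
          + u ^ 2 / sin u * cos (N * u))).
    + apply @is_derive_minus; [apply DE; lra|].
      auto_derive; [lra|]. field. lra.
    + rewrite sum_n_Rmult_l.
      assert (Hsum := sum_sin_odd n u). fold N in Hsum.
      fold m in Hsum.
      replace (sum_n (fun k => 2 * sin (m k * u)) n : R) with ((1 - cos (N * u)) / sin u)
        by (rewrite <- Hsum; unfold m; field; lra).
      field. lra.
  - intros u _. auto_derive; [trivial|]. ring.
  - intros u Hu.
    assert (H0 : 0 < 1 / N) by (apply Rdiv_lt_0_compat; lra).
    destruct (Req_dec u 0) as [->|Hu0].
    { rewrite Rmult_0_r, sin_0. unfold Rdiv in *.
      replace (- _) with 0 by ring. rewrite Rabs_R0. lra. }
    (* Source of the constant 15: [u <= 3 * sin u] gives [2 * u * sin u <= 6 * sin u ^ 2] and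
       [u ^ 2 <= 9 * sin u ^ 2]. *)
    assert (Hs := sin_ge_third u Hu).
    rewrite Rabs_Ropp, Rabs_mult.
    apply Rle_trans with (15 * (1 / N)); [|right; field; lra].
    apply Rmult_le_compat; try apply Rabs_pos.
    + unfold Rdiv. rewrite Rabs_mult, Rabs_inv, (Rabs_pos_eq (sin u ^ 2))
        by apply pow2_ge_0.
      apply Rmult_le_reg_r with (sin u ^ 2); [apply pow_lt; lra|].
      rewrite Rmult_assoc, Rinv_l, Rmult_1_r by (apply pow_nonzero; lra).
      assert (Hc := COS_bound u). assert (Hs1 := SIN_bound u).
      apply Rabs_le. nra.
    + unfold Rdiv. rewrite Rabs_mult, Rabs_inv, (Rabs_pos_eq N) by lra.
      apply Rmult_le_compat_r; [apply Rlt_le, Rinv_0_lt_compat; lra|].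
      apply Rabs_le. apply SIN_bound.
Qed.

(** * The constants and the closed form *)

Lemma Catalan_is_series :
  is_series (fun n : nat => (-1) ^ n / (2 * INR n + 1) ^ 2) Catalan.
Proof.
  apply Series_correct, ex_series_of_telescope. intros n.
  assert (Hn := pos_INR n).
  unfold Rdiv at 1. rewrite Rabs_mult, pow_1_abs, Rmult_1_l, Rabs_inv.
  rewrite Rabs_pos_eq by apply pow2_ge_0.
  replace (2 * (_ - _)) with (/ ((INR n + 1) * (INR n + 2) / 2)) by (field; lra).
  apply Rinv_le_contravar; nra.
Qed.

Lemma zeta3_is_series : is_series (fun k : nat => 1 / INR (S k) ^ 3) zeta3.
Proof.
  apply Series_correct, ex_series_of_telescope. intros n.
  rewrite S_INR. assert (Hn := pos_INR n).
  unfold Rdiv at 1. rewrite Rmult_1_l, Rabs_inv.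
  rewrite Rabs_pos_eq by (apply pow_le; lra).
  replace (2 * (_ - _)) with (/ ((INR n + 1) * (INR n + 2) / 2)) by (field; lra).
  apply Rinv_le_contravar; nra.
Qed.

Lemma odd_cubes_is_series :
  is_series (fun k : nat => 1 / (2 * INR k + 1) ^ 3) (7 / 8 * zeta3).
Proof.
  set (T := sum_n (fun k : nat => 1 / INR (S k) ^ 3)).
  assert (HT : is_lim_seq T zeta3) by exact zeta3_is_series.
  assert (Hsub : is_lim_seq (fun n => T (2 * n + 1)%nat) zeta3).
  { apply is_lim_seq_subseq; [|exact HT].
    apply eventually_subseq. intros n. lia. }
  change (is_lim_seq (sum_n (fun k : nat => 1 / (2 * INR k + 1) ^ 3)) (7 / 8 * zeta3)).
  (* [T (2 * n + 1)] runs over the bases 1 to [2 * n + 2]; its even bases contribute [1 / 8 * T n],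
     leaving the odd ones up to [2 * n + 1]. *)
  apply is_lim_seq_ext with (fun n => T (2 * n + 1)%nat - 1 / 8 * T n).
  - intros n. unfold T. induction n as [|n IH].
    + simpl (2 * 0 + 1)%nat. rewrite sum_Sn_R, !sum_O. simpl. field.
    + replace (2 * S n + 1)%nat with (S (S (2 * n + 1))) by lia.
      rewrite !sum_Sn_R, <- IH.
      replace (INR (S (S (2 * n + 1)))) with (2 * INR (S n) + 1)
        by (rewrite !S_INR, plus_INR, mult_INR; simpl (INR 2); simpl (INR 1); ring).
      replace (INR (S (S (S (2 * n + 1))))) with (2 * (INR (S n) + 1))
        by (rewrite !S_INR, plus_INR, mult_INR; simpl (INR 2); simpl (INR 1); ring).
      rewrite (S_INR (S n)). assert (Hn := pos_INR (S n)). field. lra.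
  - replace (7 / 8 * zeta3) with (zeta3 - 1 / 8 * zeta3) by field.
    apply is_lim_seq_minus'; [exact Hsub|].
    apply (is_lim_seq_scal_l T (1 / 8) zeta3 HT).
Qed.

(** The odd sine sums converge to [4 * J] by the error bound, and to a combination of [Catalan] and
    [zeta3] by linearity; uniqueness of the sum equates the two. *)
Lemma RInt_atan_sqr_div_value :
  2 * RInt (fun x => atan (1 * x) ^ 2 / x) 0 1 = PI * Catalan - 7 / 4 * zeta3.
Proof.
  set (J := RInt _ _ _).
  assert (H1 : is_series (fun k => 2 * (PI * ((-1) ^ k / (2 * INR k + 1) ^ 2)
                                        - 2 / (2 * INR k + 1) ^ 3)) (4 * J)).
  { apply (is_series_of_error_le _ _ 15). intros n.
    rewrite Rabs_minus_sym. apply RInt_atan_sqr_div_odd_sum_le. }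
  assert (H2 := is_series_scal 2 _ _
    (is_series_minus _ _ _ _
      (is_series_scal PI _ _ Catalan_is_series)
      (is_series_scal 2 _ _ odd_cubes_is_series))).
  assert (H : 4 * J = 2 * (PI * Catalan - 2 * (7 / 8 * zeta3))).
  { rewrite <- (is_series_unique _ _ H1).
    apply is_series_unique. refine (is_series_ext _ _ _ _ H2).
    intros k. assert (Hk := pos_INR k).
    change (2 * (PI * ((-1) ^ k / (2 * INR k + 1) ^ 2)
                 - 2 * (1 / (2 * INR k + 1) ^ 3))
            = 2 * (PI * ((-1) ^ k / (2 * INR k + 1) ^ 2) - 2 / (2 * INR k + 1) ^ 3)).
    field. lra. }
  lra.
Qed.

(** * The expansion for all alpha and the value at alpha = 1 *)

Theorem proposition9 :
  (forall alpha : R, Rabs alpha <= 1 ->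
     let f := fun x : R => (atan (alpha * x)) ^ 2 / x in
     let a := fun n : nat =>
       (-1) ^ (n - 1) * (h n / INR n ^ 2) * alpha ^ (2 * n) in
     ex_RInt f 0 1 /\
     ex_series (fun k : nat => a (S k)) /\
     RInt f 0 1 = 1 / 2 * Series (fun k : nat => a (S k))) /\
  (let b := fun n : nat => (-1) ^ (n - 1) * (h n / INR n ^ 2) in
   is_series (fun k : nat => b (S k)) (PI * Catalan - 7 / 4 * zeta3)).
Proof.
  split.
  - intros alpha Ha f a.
    assert (Hs : is_series (fun k : nat => a (S k)) (2 * RInt f 0 1)).
    { refine (is_series_ext _ _ _ _ (is_series_RInt_atan_sqr_div alpha Ha)).
      intros k. unfold a. now rewrite Nat.sub_1_r. }
    split; [apply atan_sqr_div_ex_RInt|]. split; [now eexists; apply Hs|].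
    rewrite (is_series_unique _ _ Hs).
    generalize (RInt f 0 1 : R). intros y. change (y = 1 / 2 * (2 * y)). field.
  - intros b. rewrite <- RInt_atan_sqr_div_value.
    refine (is_series_ext _ _ _ _ (is_series_RInt_atan_sqr_div 1 _)).
    + intros k. unfold b. now rewrite Nat.sub_1_r, pow1, Rmult_1_r.
    + rewrite Rabs_R1. lra.
Qed.
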